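(* Let $n\geq 1$, let $0\leq l\leq n$, and let $z_{ij}\in\mathbb{T}$ for all $i\neq j$ with $1\leq i,j\leq n$ be such that $z_{ji}=\overline{z_{ij}}$. Then the standard representation $\pi_{\mathrm s}:\mathcal A_{\{z_{ij}\};l,n-l}\to B(H_{l,n-l})$ is injective.
   Context: $\mathbb{T}$ is the unit circle in $\mathbb{C}$ and $\mathbb{N}_0=\{0,1,2,\dotsc\}$. $\mathcal A_{\{z_{ij}\};l,n-l}$ denotes the universal unital $C^*$-algebra generated by elements $s_1,\dotsc,s_n$ such that $s_i^*s_j=\overline{z_{ij}}\,s_js_i^*$ and $s_is_j=z_{ij}s_js_i$ for all $i\neq j$, $s_i^*s_i=1$ for $i=1,\dotsc,l$, and $s_i^*s_i=s_is_i^*=1$ for $i=l+1,\dotsc,n$. Set $H_{l,n-l}=\ell^2(\mathbb{N}_0)^{\otimes l}\otimes\ell^2(\mathbb{Z})^{\otimes(n-l)}$ (read as $\ell^2(\mathbb Z)^{\otimes n}$ if $l=0$ and as $\ell^2(\mathbb N_0)^{\otimes n}$ if $l=n$), with canonical orthonormal basis $\epsilon_{k_1,\dotsc,k_n}=\epsilon_{k_1}\otimes\dotsb\otimes\epsilon_{k_n}$, where $k_1,\dotsc,k_l\geq 0$ and $k_{l+1},\dotsc,k_n\in\mathbb{Z}$. For $i=1,\dotsc,n$, the isometry $S_i\in B(H_{l,n-l})$ is defined by $$S_i\,\epsilon_{k_1,\dotsc,k_n}=z_{i,1}^{k_1}\dotsm z_{i,i-1}^{k_{i-1}}\,\epsilon_{k_1,\dotsc,k_{i-1},k_i+1,k_{i+1},\dotsc,k_n},$$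 where empty products are read as $1$. The $S_i$ satisfy the defining relations of $\mathcal A_{\{z_{ij}\};l,n-l}$; the standard representation $\pi_{\mathrm s}$ is the unique unital representation ($*$-homomorphism) $\pi_{\mathrm s}:\mathcal A_{\{z_{ij}\};l,n-l}\to B(H_{l,n-l})$ with $\pi_{\mathrm s}(s_i)=S_i$ for $i=1,\dotsc,n$. *)

(* Defs.v *)
From HB Require Import structures.
From mathcomp Require Import all_boot all_order all_algebra.
From mathcomp Require Import finmap complex.
From mathcomp Require Import ring lra.
From mathcomp Require Import boolp classical_sets functions cardinality fsbigop.
From mathcomp Require Import reals ereal topology normedtype sequences esum.
From mathcomp Require showcase.summability.

Set Implicit Arguments.
Unset Strict Implicit.
Unset Printing Implicit Defensive.
Import Order.TTheory GRing.Theory Num.Theory.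
Import numFieldNormedType.Exports.
Local Open Scope classical_set_scope.
Local Open Scope ring_scope.
Local Open Scope complex_scope.

(* Unital C*-algebras.  The norm is a field of the mixin because algType and
   the library's normed modules have no common join in the hierarchy.
   algType excludes the zero ring. *)
HB.mixin Record Algebra_isCStarAlgebra (R : realType) A
    of GRing.Algebra R[i] A := {
  star : A -> A;
  starK : involutive star;
  starD : {morph star : x y / x + y};
  starZ : forall (c : R[i]) (x : A), star (c *: x) = c^* *: star x;
  starM : forall x y : A, star (x * y) = star y * star x;
  cnorm : A -> R;
  cnorm_eq0 : forall x : A, cnorm x = 0 -> x = 0;
  cnormD : forall x y : A, cnorm (x + y) <= cnorm x + cnorm y;
  cnormZ : forall (c : R[i]) (x : A), cnorm (c *: x) = complex.Re `|c| * cnorm x;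
  cnormM : forall x y : A, cnorm (x * y) <= cnorm x * cnorm y;
  cnorm_star_mul : forall x : A, cnorm (star x * x) = cnorm x ^+ 2;
  cnorm_complete : forall u : nat -> A,
    (forall e : R, 0 < e -> exists N : nat, forall m k : nat,
       (N <= m)%N -> (N <= k)%N -> cnorm (u m - u k) < e) ->
    exists a : A, cnorm (u k - a) @[k --> \oo] --> (0 : R)
}.

#[short(type="cstarAlgType")]
HB.structure Definition CStarAlgebra (R : realType) :=
  {A of GRing.Algebra R[i] A & Algebra_isCStarAlgebra R A}.

(* The C*-algebra generated by a family is the smallest norm-closed unital
   *-subalgebra containing it. *)
Definition norm_closed (R : realType) (A : cstarAlgType R) (B : set A) :=
  forall (u : nat -> A) (a : A), (forall k, B (u k)) ->
    cnorm (u k - a) @[k --> \oo] --> (0 : R) -> B a.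

Definition star_subalgebra (R : realType) (A : cstarAlgType R) (B : set A) :=
  [/\ B 1,
      forall (c : R[i]) (x y : A), B x -> B y -> B (c *: x + y),
      forall x y : A, B x -> B y -> B (x * y) &
      forall x : A, B x -> B (star x)].

Definition generates (R : realType) (A : cstarAlgType R) (I : Type)
    (s : I -> A) :=
  forall B : set A, star_subalgebra B -> norm_closed B ->
    (forall i, B (s i)) -> B = setT.

(* Indices are 0-based: the proper isometries are the s i with i < l. *)
Definition twisted_relations (R : realType) (n l : nat)
    (z : 'I_n -> 'I_n -> R[i]) (A : cstarAlgType R) (s : 'I_n -> A) :=
  [/\ forall i j, i != j -> star (s i) * s j = (z i j)^* *: (s j * star (s i)),
      forall i j, i != j -> s i * s j = z i j *: (s j * s i),
      forall i : 'I_n, (i < l)%N -> star (s i) * s i = 1 &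
      forall i : 'I_n, (l <= i)%N ->
        star (s i) * s i = 1 /\ s i * star (s i) = 1].

(* The homomorphism f is unique, since s generates A. *)
Definition is_universal (R : realType) (n l : nat)
    (z : 'I_n -> 'I_n -> R[i]) (A : cstarAlgType R) (s : 'I_n -> A) :=
  [/\ twisted_relations l z s,
      generates s &
      forall (B : cstarAlgType R) (t : 'I_n -> B), twisted_relations l z t ->
        exists2 f : {lrmorphism A -> B},
          (forall a, f (star a) = star (f a)) & (forall i, f (s i) = t i)].

Definition sqnormc (R : realType) (c : R[i]) : R :=
  complex.Re c ^+ 2 + complex.Im c ^+ 2.

Definition square_summable (R : realType) (I : choiceType) (x : I -> R[i]^o) :=
  (\esum_(k in [set: I]) (sqnormc (x k))%:E < +oo)%E.

Definition square_summableb (R : realType) (I : choiceType)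
    : {pred I -> R[i]^o} :=
  fun x => `[< square_summable x >].

Lemma sqnormc_ge0 (R : realType) (c : R[i]) : 0 <= sqnormc c.
Proof. by rewrite addr_ge0 ?sqr_ge0. Qed.

Lemma sqnormcM (R : realType) (c d : R[i]) :
  sqnormc (c * d) = sqnormc c * sqnormc d.
Proof. by case: c d => [a b] [a' b']; rewrite /sqnormc /=; ring. Qed.

Lemma sqnormcD (R : realType) (c d : R[i]) :
  sqnormc (c + d) <= 2 * sqnormc c + 2 * sqnormc d.
Proof.
case: c d => [a b] [a' b']; rewrite /sqnormc /=.
have := sqr_ge0 (a - a'); have := sqr_ge0 (b - b'); nra.
Qed.

Lemma esumZ_le (R : realType) (I : choiceType) (c : R) (f : I -> R) :
  0 <= c -> (forall k, 0 <= f k) ->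
  (\esum_(k in [set: I]) (c * f k)%:E
     <= c%:E * \esum_(k in [set: I]) (f k)%:E)%E.
Proof.
move=> c0 f0; apply: ge_ereal_sup => _ [J [Jfin _] <-].
under eq_fsbigr do rewrite EFinM.
rewrite -ge0_mule_fsumr; last by move=> k; rewrite lee_fin.
apply: lee_wpmul2l; first by rewrite lee_fin.
by apply: esum_ge; exists J => //; split.
Qed.

Lemma square_summable_linear (R : realType) (I : choiceType) (c : R[i])
    (x y : I -> R[i]^o) :
  square_summable x -> square_summable y -> square_summable (c *: x + y).
Proof.
rewrite /square_summable => x2 y2.
have c0 : 0 <= 2 * sqnormc c by rewrite mulr_ge0 ?sqnormc_ge0.
have scale_lty (d : R) (w : I -> R[i]^o) : 0 <= d ->
    (\esum_(k in [set: I]) (sqnormc (w k))%:E < +oo)%E ->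
    (\esum_(k in [set: I]) (d * sqnormc (w k))%:E < +oo)%E.
  move=> d0 w2; apply: le_lt_trans (esumZ_le d0 (fun k => sqnormc_ge0 (w k))) _.
  by apply: lte_mul_pinfty; rewrite ?lee_fin.
apply: (@le_lt_trans _ _ (\esum_(k in [set: I])
  ((2 * sqnormc c * sqnormc (x k))%:E + (2 * sqnormc (y k))%:E))%E).
  apply: le_esum => k _; rewrite -EFinD lee_fin.
  by apply: le_trans (sqnormcD _ _) _; rewrite sqnormcM mulrA.
rewrite esumD.
- by apply: lte_add_pinfty; apply: scale_lty.
- by move=> k _; rewrite lee_fin mulr_ge0 ?sqnormc_ge0.
- by move=> k _; rewrite lee_fin mulr_ge0 ?sqnormc_ge0.
Qed.

Lemma square_summable_finsupp (R : realType) (I : choiceType) (k0 : I)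
    (x : I -> R[i]^o) : (forall k, k != k0 -> x k = 0) -> square_summable x.
Proof.
move=> x0; rewrite /square_summable (esumID [set k0]); last first.
  by move=> k _; rewrite lee_fin sqnormc_ge0.
rewrite setTI esum_set1 ?lee_fin ?sqnormc_ge0// esum1 ?adde0 ?ltry//.
move=> k [_ /= /eqP kk0].
by rewrite x0 // /sqnormc /= expr0n /= addr0.
Qed.

Lemma square_summableb_closed (R : realType) (I : choiceType) :
  GRing.subsemimod_closed (@square_summableb R I).
Proof.
have z2 : @square_summable R I 0.
  rewrite /square_summable esum1 ?ltry// => k _.
  by rewrite /sqnormc /= expr0n /= addr0.
split; first split.
- exact/asboolP.
- move=> x y /asboolP x2 /asboolP y2; apply/asboolP.
  by rewrite -[x]scale1r; apply: square_summable_linear.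
- move=> c x /asboolP x2; apply/asboolP.
  by rewrite -[_ *: _]addr0; apply: square_summable_linear.
Qed.

HB.instance Definition _ (R : realType) (I : choiceType) :=
  GRing.isSubmodClosed.Build R[i] (I -> R[i]^o) (@square_summableb R I)
    (@square_summableb_closed R I).

Record l2 (R : realType) (I : choiceType) := L2 {
  l2val :> I -> R[i]^o;
  l2valP : l2val \in @square_summableb R I
}.

HB.instance Definition _ (R : realType) (I : choiceType) :=
  [isSub for @l2val R I].
HB.instance Definition _ (R : realType) (I : choiceType) :=
  [Choice of l2 R I by <:].
HB.instance Definition _ (R : realType) (I : choiceType) :=
  [SubChoice_isSubZmodule of l2 R I by <:].
HB.instance Definition _ (R : realType) (I : choiceType) :=
  [SubZmodule_isSubLmodule of l2 R I by <:].

Definition l2norm (R : realType) (I : choiceType) (x : l2 R I) : R :=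
  Num.sqrt (fine (\esum_(k in [set: I]) (sqnormc (x k))%:E)).

(* The sum is the limit of the finite partial sums. *)
Definition l2dot (R : realType) (I : choiceType) (x y : l2 R I) : R[i] :=
  summability.sum (fun k : I => x k * (y k)^* : R[i]^o).

Lemma l2basis_subproof (R : realType) (I : choiceType) (k : I) :
  (fun m => (m == k)%:R : R[i]^o) \in @square_summableb R I.
Proof.
by apply/asboolP/(@square_summable_finsupp _ _ k) => m /negPf ->.
Qed.

Definition l2basis (R : realType) (I : choiceType) (k : I) : l2 R I :=
  L2 (l2basis_subproof R k).

Definition bounded_operator (R : realType) (I : choiceType)
    (T : l2 R I -> l2 R I) :=
  linear T /\ exists M : R, forall x, l2norm (T x) <= M * l2norm x.

(* Unital *-homomorphisms from A to the bounded operators on l2 R I. *)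
Definition star_representation (R : realType) (I : choiceType)
    (A : cstarAlgType R) (pi : A -> l2 R I -> l2 R I) :=
  [/\ forall a, bounded_operator (pi a),
      forall (c : R[i]) a b x, pi (c *: a + b) x = c *: pi a x + pi b x,
      (forall a b x, pi (a * b) x = pi a (pi b x)),
      (forall x, pi 1 x = x) &
      forall a x y, l2dot (pi (star a) x) y = l2dot x (pi a y)].

(* The tensor product of l copies of l^2(N_0) and n - l copies of l^2(Z) is
   taken as l^2 of the set N_0^l x Z^(n-l) indexing its canonical basis. *)
Record multi_index (n l : nat) := MultiIndex {
  multi_index_val :> {ffun 'I_n -> int};
  multi_indexP : [forall i : 'I_n, (i < l)%N ==> (0 <= multi_index_val i)]
}.

HB.instance Definition _ (n l : nat) := [isSub for @multi_index_val n l].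
HB.instance Definition _ (n l : nat) := [Choice of multi_index n l by <:].

Lemma shift_index_subproof (n l : nat) (i : 'I_n) (k : multi_index n l) :
  [forall j : 'I_n, (j < l)%N ==> (0 <= [ffun m => k m + (m == i)%:R] j)].
Proof.
apply/forallP => j; apply/implyP => jl; rewrite ffunE.
by rewrite addr_ge0 //; move: (multi_indexP k) => /forallP/(_ j)/implyP; apply.
Qed.

(* k_i is replaced by k_i + 1. *)
Definition shift_index (n l : nat) (i : 'I_n) (k : multi_index n l)
    : multi_index n l :=
  MultiIndex (shift_index_subproof i k).

Definition is_standard_representation (R : realType) (n l : nat)
    (z : 'I_n -> 'I_n -> R[i]) (A : cstarAlgType R) (s : 'I_n -> A)
    (pi : A -> l2 R (multi_index n l) -> l2 R (multi_index n l)) :=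
  star_representation pi /\
  forall (i : 'I_n) (k : multi_index n l),
    pi (s i) (l2basis R k) =
      (\prod_(j < n | (j < i)%N) z i j ^ k j)
        *: l2basis R (shift_index i k).

(* Main.v *)
Require Import Defs.
From mathcomp Require Import all_boot all_order all_algebra complex reals.
From mathcomp Require Import finmap ring lra zify.
From mathcomp Require Import boolp classical_sets functions cardinality fsbigop.
From mathcomp Require Import ereal topology normedtype sequences esum.
From mathcomp Require showcase.summability.

(* The monomials of degree at most d number polynomially many in d.  Writing
   1 as the sum of the elements v_k f v_k^*, where v_k is the
   monomial s_1^{k_1} ... s_n^{k_n}, the exponents k_i with i <= l range over
   0..d and f is the product of the 1 - s_i s_i^* with k_i < d, one has for a
   polynomial p of degree at most d that p v_k f is the combination of the
   v_m f whose coefficients are the matrix entries of pi(p).  Hence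
   |p| <= Q(d) |pi(p)| for a polynomial Q.  For p self-adjoint, applying this
   to p^(2^j) and using |p^(2^j)| = |p|^(2^j) removes the factor Q, so that
   |p| <= |pi(p)|.  As pi is contractive, this extends to the closure of the
   polynomials, which is A. *)

Set Implicit Arguments.
Unset Strict Implicit.
Unset Printing Implicit Defensive.
Import Order.TTheory GRing.Theory Num.Theory.
Import numFieldNormedType.Exports.
Local Open Scope classical_set_scope.
Local Open Scope ring_scope.
Local Open Scope complex_scope.

(** * Square-summable families *)

Section SquareSummable.
Variables (R : realType) (I : choiceType).
Implicit Types (x y : l2 R I) (c : R[i]).

Lemma partial_sumE (V : zmodType) (f : I -> V) (J : {fset I}) :
  summability.partial_sum f J = \sum_(k <- J) f k.
Proof. by rewrite big_seq_fsetE. Qed.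

Definition l2sq x : R := fine (\esum_(k in [set: I]) (sqnormc (x k))%:E).

Lemma l2_esum_fin x : (\esum_(k in [set: I]) (sqnormc (x k))%:E)%E \is a fin_num.
Proof.
rewrite ge0_fin_numE; last by apply: esum_ge0 => k _; rewrite lee_fin sqnormc_ge0.
exact/asboolP/(l2valP x).
Qed.

Lemma l2sq_ge0 x : 0 <= l2sq x.
Proof. by rewrite fine_ge0// esum_ge0// => k _; rewrite lee_fin sqnormc_ge0. Qed.

Lemma l2norm_sqr x : l2norm x ^+ 2 = l2sq x.
Proof. by rewrite sqr_sqrtr// l2sq_ge0. Qed.

Lemma l2norm_ge0 x : 0 <= l2norm x.
Proof. exact: sqrtr_ge0. Qed.

Lemma partial_sqnormc_le x (J : {fset I}) :
  \sum_(k <- J) sqnormc (x k) <= l2sq x.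
Proof.
rewrite -lee_fin fineK ?l2_esum_fin//; apply: esum_ge; exists [set` J].
  by split; [exact: finite_fset|].
by rewrite -fsbig_seq ?fset_uniq// sumEFin.
Qed.

Lemma sqnormc_le_l2sq x k : sqnormc (x k) <= l2sq x.
Proof. by have := partial_sqnormc_le x [fset k]%fset; rewrite big_seq_fset1. Qed.

Lemma partial_sqnormc_gt x e : 0 < e ->
  exists J : {fset I}, l2sq x - e < \sum_(k <- J) sqnormc (x k).
Proof.
move=> e0.
have [_ [X [finX _] <-]] := ub_ereal_sup_adherent e0 (l2_esum_fin x).
rewrite -[ereal_sup _]/(\esum_(k in [set: I]) (sqnormc (x k))%:E)%E.
rewrite fsbig_finite//= sumEFin -(fineK (l2_esum_fin x)) -EFinB lte_fin => lt_e.
by exists (fset_set X).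
Qed.

Lemma partial_sqnormc_cvg x :
  (summability.partial_sum (fun k => sqnormc (x k)) @ summability.totally
     --> l2sq x).
Proof.
have ? := @summability.totally_filter I.
apply/cvgrPdist_lt => e e0.
have [J ltJ] := partial_sqnormc_gt x e0.
exists J => // B /= JB; rewrite partial_sumE.
have leJB : \sum_(k <- J) sqnormc (x k) <= \sum_(k <- B) sqnormc (x k).
  rewrite [leRHS](big_fsetID _ (mem J))/=.
  rewrite (_ : [fset y in B | y \in J]%fset = J); last first.
    apply/fsetP => k; rewrite !inE /=; apply/andP/idP => [[]//|kJ].
    by split=> //; apply: (fsubsetP JB).
  by rewrite lerDl sumr_ge0// => k _; rewrite sqnormc_ge0.
have leB := partial_sqnormc_le x B.
rewrite ger0_norm ?subr_ge0//; lra.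
Qed.

Lemma l2valD x y k : (x + y) k = x k + y k. Proof. by []. Qed.
Lemma l2valN x k : (- x) k = - x k. Proof. by []. Qed.
Lemma l2valZ c x k : (c *: x) k = c * x k. Proof. by []. Qed.
Lemma l2val0 k : (0 : l2 R I) k = 0. Proof. by []. Qed.
Lemma l2basisE (d k : I) : l2basis R d k = (k == d)%:R :> R[i]. Proof. by []. Qed.

Lemma l2P x y : (forall k, x k = y k) -> x = y.
Proof. by move=> xy; apply/val_inj/funext. Qed.

Lemma l2sq_cvg_unique x (r : R) :
  (summability.partial_sum (fun k => sqnormc (x k)) @ summability.totally
     --> r) -> l2sq x = r.
Proof.
move=> cr; have ? := @summability.totally_filter I.
rewrite -(cvg_lim (@norm_hausdorff _ R) cr).
by rewrite (cvg_lim (@norm_hausdorff _ R) (@partial_sqnormc_cvg x)).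
Qed.

Lemma l2sqZ c x : l2sq (c *: x) = sqnormc c * l2sq x.
Proof.
apply: l2sq_cvg_unique; have ? := @summability.totally_filter I.
rewrite (_ : summability.partial_sum _ =
  (fun J => sqnormc c * summability.partial_sum (fun k => sqnormc (x k)) J)).
  by apply: cvgM; [exact: cvg_cst|exact: partial_sqnormc_cvg].
apply/funext => J; rewrite /summability.partial_sum mulr_sumr.
by apply: eq_bigr => k _; rewrite l2valZ sqnormcM.
Qed.

Lemma l2sq_basis (d : I) : l2sq (l2basis R d) = 1.
Proof.
rewrite /l2sq (esumID [set d]) => [|k _]; last by rewrite lee_fin sqnormc_ge0.
rewrite setTI esum_set1 ?lee_fin ?sqnormc_ge0//.
rewrite esum1 ?adde0 => [|k [_ /eqP kd]]; last first.
  by rewrite l2basisE (negPf kd) /sqnormc /= expr0n /= addr0.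
by rewrite l2basisE eqxx /sqnormc /= expr0n expr1n /= addr0.
Qed.

Lemma complex_cvg (T : Type) (F : set_system T) (f : T -> R[i]^o) (a b : R) :
  Filter F -> ((fun t => complex.Re (f t)) @ F --> a) ->
  ((fun t => complex.Im (f t)) @ F --> b) -> (f @ F --> (a +i* b : R[i]^o)).
Proof.
move=> FF /cvgrPdist_lt fa /cvgrPdist_lt fb; apply/cvgrPdist_lt => -[e e'].
rewrite ltcE/= => /andP[/eqP -> e0].
have e20 : 0 < e / 2 by rewrite divr_gt0.
near=> t.
have ha : `|a - complex.Re (f t)| < e / 2 by near: t; apply: fa.
have hb : `|b - complex.Im (f t)| < e / 2 by near: t; apply: fb.
case: (f t) ha hb => u v /= ha hb.
rewrite normc_def ltcR/= -(ltr_pXn2r (_ : (0 < 2)%N))// ?nnegrE ?sqrtr_ge0 ?(ltW e0)//.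
rewrite sqr_sqrtr ?addr_ge0 ?sqr_ge0//.
rewrite -(real_normK (num_real (a - u))) -(real_normK (num_real (b - v))).
have := normr_ge0 (a - u); have := normr_ge0 (b - v); nra.
Unshelve. all: by end_near.
Qed.

Lemma conjE c : Num.conj c = complex.Re c -i* complex.Im c.
Proof. by case: c. Qed.

(** Polarization, applied termwise to the real part and to [- 'i *: x] for the imaginary part. It
    carries convergence over from the sums of squares, so the limit that defines [l2dot] exists. *)
Lemma l2dot_polar x y :
  l2dot x y = ((l2sq x + l2sq y - l2sq (x - y)) / 2)
           +i* ((l2sq (- 'i *: x) + l2sq y - l2sq (- 'i *: x - y)) / 2).
Proof.
have ? := @summability.totally_filter I.
apply: (@cvg_lim R[i]^o (@norm_hausdorff _ _)).
have polar (u v : l2 R I) :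
  (summability.partial_sum (fun k => complex.Re (u k * Num.conj (v k))) @
     summability.totally --> (l2sq u + l2sq v - l2sq (u - v)) / 2).
  rewrite (_ : summability.partial_sum _ = (fun J =>
    (summability.partial_sum (fun k => sqnormc (u k)) J +
     summability.partial_sum (fun k => sqnormc (v k)) J -
     summability.partial_sum (fun k => sqnormc ((u - v) k)) J) / 2)).
    apply: cvgM; last exact: cvg_cst.
    by apply: cvgB; [apply: cvgD|]; exact: partial_sqnormc_cvg.
  apply/funext => J; rewrite /summability.partial_sum -big_split -sumrB mulr_suml.
  apply: eq_bigr => k _; rewrite l2valD l2valN conjE.
  by case: (u _) (v _) => [a b] [a' b']; rewrite /sqnormc /=; field.
apply: complex_cvg.
  rewrite (_ : (fun _ => _) = summability.partial_sum
      (fun k => complex.Re (x k * Num.conj (y k)))).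
    exact: polar.
  by apply/funext => J; rewrite /summability.partial_sum /= raddf_sum.
rewrite (_ : (fun _ => _) = summability.partial_sum
    (fun k => complex.Re ((- 'i *: x) k * Num.conj (y k)))); first exact: polar.
apply/funext => J; rewrite /summability.partial_sum raddf_sum.
apply: eq_bigr => k _; rewrite l2valZ conjE.
by case: (x _) (y _) => [a b] [a' b'] /=; ring.
Qed.

Lemma l2sqB x y : l2sq (x - y) = l2sq x + l2sq y - 2 * complex.Re (l2dot x y).
Proof. by rewrite l2dot_polar /=; field. Qed.

Lemma Re_l2dotxx x : complex.Re (l2dot x x) = l2sq x.
Proof.
rewrite l2dot_polar/= subrr.
have -> : l2sq 0 = 0.
  by rewrite -(scale0r 0) l2sqZ /sqnormc /= expr0n /= addr0 mul0r.
by field.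
Qed.

Lemma l2dot_basisr c x (d : I) : l2dot x (c *: l2basis R d) = x d * Num.conj c.
Proof.
have ? := @summability.totally_filter I.
apply: (@cvg_lim R[i]^o (@norm_hausdorff _ _)).
(* The partial sums are constant as soon as the finite set contains [d]. *)
apply: cvg_near_cst; exists [fset d]%fset => // B dB.
rewrite partial_sumE.
rewrite (big_fsetD1 d); last by apply: (fsubsetP dB); rewrite inE.
rewrite l2valZ l2basisE eqxx mulr1 big_seq big1 => [|k]; first exact: addr0.
rewrite !inE => /andP[/negPf kd _].
by rewrite l2valZ l2basisE kd mulr0 rmorph0 mulr0.
Qed.

End SquareSummable.

(** * C*-algebras and their representations *)

Section CStarAlgebraTheory.
Variables (R : realType) (A : cstarAlgType R).
Implicit Types (x y g h : A) (c : R[i]).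

Lemma Re_normC_real (r : R) : complex.Re `|r%:C| = `|r|.
Proof. by rewrite normc_def /= expr0n addr0 sqrtr_sqr. Qed.

Lemma cnormN x : cnorm (- x) = cnorm x.
Proof. by rewrite -scaleN1r cnormZ normrN1 mul1r. Qed.

Lemma cnorm0 : cnorm (0 : A) = 0.
Proof. by rewrite -(scale0r 0) cnormZ normr0 mul0r. Qed.

Lemma cnorm_ge0 x : 0 <= cnorm x.
Proof. by have := cnormD x (- x); rewrite subrr cnorm0 cnormN; lra. Qed.

Lemma cnormB x y : cnorm (x - y) <= cnorm x + cnorm y.
Proof. by rewrite -(cnormN y); exact: cnormD. Qed.

Lemma cnorm_distC x y : cnorm (x - y) = cnorm (y - x).
Proof. by rewrite -cnormN opprB. Qed.

Lemma star0 : star (0 : A) = 0.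
Proof. by apply: (@addrI _ (star 0)); rewrite -starD !addr0. Qed.

Lemma starN x : star (- x) = - star x.
Proof. by apply: (@addrI _ (star x)); rewrite -starD !subrr star0. Qed.

Lemma starB x y : star (x - y) = star x - star y.
Proof. by rewrite starD starN. Qed.

Lemma star1 : star (1 : A) = 1.
Proof. by rewrite -[LHS]mulr1 -{2}(starK 1) -starM mulr1 starK. Qed.

Lemma starX x k : star (x ^+ k) = star x ^+ k.
Proof. by elim: k => [|k IH]; rewrite ?star1// exprS starM IH exprSr. Qed.

Lemma le_of_sqr_le_mul (a b : R) : 0 <= a -> 0 <= b -> a ^+ 2 <= b * a -> a <= b.
Proof. by move=> a0 b0 ab; case: (leP a b) => // lt_ba; nra. Qed.

Lemma cnorm_star x : cnorm (star x) = cnorm x.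
Proof.
have le y : cnorm y <= cnorm (star y).
  by apply: le_of_sqr_le_mul; rewrite ?cnorm_ge0// -cnorm_star_mul cnormM.
by apply/le_anti; rewrite le andbT -{2}(starK x) le.
Qed.

Lemma cnorm1_le1 : cnorm (1 : A) <= 1.
Proof.
apply: le_of_sqr_le_mul; rewrite ?cnorm_ge0// -cnorm_star_mul star1 mulr1; lra.
Qed.

Lemma cnorm_isometry x : star x * x = 1 -> cnorm x <= 1.
Proof.
move=> x1; have := cnorm_star_mul x; rewrite x1 => e.
have := cnorm1_le1; have := cnorm_ge0 x; rewrite e; nra.
Qed.

Lemma cnormX_le x k : cnorm (x ^+ k) <= cnorm x ^+ k.
Proof.
elim: k => [|k IH]; first by rewrite !expr0 cnorm1_le1.
by rewrite !exprS; apply: le_trans (cnormM _ _) _; rewrite ler_wpM2l ?cnorm_ge0.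
Qed.

Lemma cnorm_sum (J : Type) (r : seq J) (P : pred J) (F : J -> A) :
  cnorm (\sum_(j <- r | P j) F j) <= \sum_(j <- r | P j) cnorm (F j).
Proof.
elim/big_ind2: _ => [|a x b y xa yb|//]; first by rewrite cnorm0.
by apply: le_trans (cnormD _ _) _; exact: lerD.
Qed.

(** For self-adjoint [h] the C*-identity reads |h^2| = |h|^2, and h^(2^j) is again self-adjoint, so
    squaring can be iterated. *)
Lemma cnorm_selfadjointX2 h j : star h = h ->
  cnorm (h ^+ (2 ^ j)) = cnorm h ^+ (2 ^ j).
Proof.
move=> hh; elim: j => [|j IH]; first by rewrite !expr1.
by rewrite expnSr !exprM -IH -cnorm_star_mul starX hh.
Qed.

(** The left inverse is the limit of the geometric series in [g], which is Cauchy and hence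
    convergent by completeness. *)
Lemma neumann g : cnorm g < 1 -> exists r, r * (1 - g) = 1.
Proof.
move=> g1; set q := cnorm g; have q0 : 0 <= q := cnorm_ge0 g.
pose u k := \sum_(j < k) g ^+ j.
have tail m k : (k <= m)%N -> (1 - q) * cnorm (u m - u k) <= q ^+ k.
  move=> km; rewrite -(subnKC km) /u big_split_ord/= [X in cnorm X]addrC addKr.
  apply: (@le_trans _ _ ((1 - q) * \sum_(i < (m - k)%N) q ^+ (k + i))).
    rewrite ler_pM2l ?subr_gt0//; apply: le_trans (cnorm_sum _ _ _) _.
    by apply: ler_sum => i _; exact: cnormX_le.
  under eq_bigr do rewrite exprD.
  rewrite -mulr_sumr mulrCA -opprB mulNr -subrX1 opprB.
  by rewrite ler_piMr ?exprn_ge0// lerBlDl lerDr exprn_ge0.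
have qk0 : q ^+ k @[k --> \oo] --> (0 : R).
  by apply: cvg_expr; rewrite ger0_norm.
have cauchy (e : R) : 0 < e -> exists N : nat, forall m k : nat,
    (N <= m)%N -> (N <= k)%N -> cnorm (u m - u k) < e.
  move=> e0; have e1 : 0 < e * (1 - q) by rewrite mulr_gt0 ?subr_gt0.
  move/cvgrPdist_lt: qk0 => /(_ _ e1) [N _ NP]; exists N => m k.
  wlog km : m k / (k <= m)%N => [W|] Nm Nk.
    by case: (leqP k m) => [/W|/ltnW/W]; [|rewrite cnorm_distC]; apply.
  have := NP k Nk; rewrite /= sub0r normrN ger0_norm ?exprn_ge0// => lt_e.
  by rewrite -(ltr_pM2l (_ : 0 < 1 - q)) ?subr_gt0//; have := tail m k km; lra.
have [r ur] := cnorm_complete u cauchy; exists r.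
apply/eqP; rewrite -subr_eq0; apply/eqP/cnorm_eq0/le_anti.
rewrite cnorm_ge0 andbT; apply/ler_addgt0Pl => e e0.
(* The error is at most |u_k - r| |1 - g| + q^k with |1 - g| <= 2, hence the tolerances e/4 and
   e/2. *)
have e2 : 0 < e / 2 by rewrite divr_gt0.
have e4 : 0 < e / 4 by rewrite divr_gt0.
near \oo => k.
have ek : cnorm (u k - r) < e / 4.
  near: k; move/cvgrPdist_lt: ur => /(_ _ e4) []N _ NP; exists N => // m /NP /=.
  by rewrite sub0r normrN ger0_norm ?cnorm_ge0.
have eq : q ^+ k < e / 2.
  near: k; move/cvgrPdist_lt: qk0 => /(_ _ e2) []N _ NP; exists N => // m /NP /=.
  by rewrite sub0r normrN ger0_norm ?exprn_ge0.
have telescope : u k * (1 - g) = 1 - g ^+ k.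
  have comm : GRing.comm (u k) (1 - g).
    apply: commr_sym; rewrite /u; apply: commr_sum => i _.
    by apply/commrX/commr_sym; apply: commrB; [exact: commr1|].
  by rewrite comm -[in RHS]opprB subrX1 -mulNr opprB.
rewrite addr0 (_ : r * (1 - g) - 1 = - ((u k - r) * (1 - g) + g ^+ k)); last first.
  by rewrite mulrBl telescope [1 - _ - _]addrAC subrK opprB.
rewrite cnormN; apply: le_trans (cnormD _ _) _.
have N2 : cnorm (1 - g) <= 2.
  by have := cnormB 1 g; have := cnorm1_le1; lra.
have := cnormM (u k - r) (1 - g); have := cnormX_le g k.
have := ler_wpM2l (cnorm_ge0 (u k - r)) N2; rewrite -/q; lra.
Unshelve. all: by end_near.
Qed.

End CStarAlgebraTheory.

(** * Contractivity of representations on self-adjoint elements *)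

Section Contraction.
Variables (R : realType) (I : choiceType) (A : cstarAlgType R).
Variable pi : A -> l2 R I -> l2 R I.
Hypothesis hpi : star_representation pi.
Implicit Types (a b h : A) (x y : l2 R I).

Lemma piD a b x : pi (a + b) x = pi a x + pi b x.
Proof. by case: hpi => _ L _ _ _; have := L 1 a b x; rewrite !scale1r. Qed.

Lemma pi0 x : pi 0 x = 0.
Proof. by apply: (@addrI _ (pi 0 x)); rewrite -piD !addr0. Qed.

Lemma piZ c a x : pi (c *: a) x = c *: pi a x.
Proof. by case: hpi => _ L _ _ _; rewrite -[_ *: a]addr0 L pi0 addr0. Qed.

Lemma piB a b x : pi (a - b) x = pi a x - pi b x.
Proof. by rewrite -scaleN1r piD piZ scaleN1r. Qed.

Lemma piM a b x : pi (a * b) x = pi a (pi b x).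
Proof. by case: hpi. Qed.

Lemma pi1 x : pi 1 x = x.
Proof. by case: hpi. Qed.

Lemma pi_star a x y : l2dot (pi (star a) x) y = l2dot x (pi a y).
Proof. by case: hpi. Qed.

Lemma pi_linear a c x y : pi a (c *: x + y) = c *: pi a x + pi a y.
Proof. by case: hpi => /(_ a) [L _] *; exact: L. Qed.

Lemma pi_addr a x y : pi a (x + y) = pi a x + pi a y.
Proof. by rewrite -[x]scale1r pi_linear !scale1r. Qed.

Lemma pi_zero a : pi a 0 = 0.
Proof. by apply: (@addrI _ (pi a 0)); rewrite -pi_addr !addr0. Qed.

Lemma pi_scaler a c x : pi a (c *: x) = c *: pi a x.
Proof. by rewrite -[_ *: x]addr0 pi_linear pi_zero addr0. Qed.

Lemma pi_l2sq_bounded a :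
  exists2 M, 0 <= M & forall x, l2sq (pi a x) <= M * l2sq x.
Proof.
have [/(_ a) [_ [M leM]] _ _ _ _] := hpi; exists (M ^+ 2); first exact: sqr_ge0.
move=> x; rewrite -!l2norm_sqr -exprMn ler_pXn2r ?nnegrE ?l2norm_ge0//.
exact: le_trans (l2norm_ge0 _) (leM x).
Qed.

Lemma Re_l2dot_selfadjoint h x : star h = h ->
  complex.Re (l2dot x (pi (h * h) x)) = l2sq (pi h x).
Proof. by move=> hh; rewrite piM -pi_star hh Re_l2dotxx. Qed.

(* If the norm of T = pi h exceeded that of h, then, scaling T to norm 1,
   1 - h^2 would be invertible, so |x|^2 <= C |x - T^2 x|^2 <=
   C (|x|^2 - |Tx|^2), which bounds |T| away from 1. *)
Lemma pi_contraction h x : star h = h -> l2sq (pi h x) <= cnorm h ^+ 2 * l2sq x.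
Proof.
move=> hh.
pose S := [set M : R | 0 <= M /\ forall y, l2sq (pi h y) <= M * l2sq y].
have [M0 M0_ge0 leM0] := pi_l2sq_bounded h.
have S0 : S M0 by [].
have hasS : has_inf S by split; [exists M0|exists 0 => M []].
(* [t] is the square of the operator norm of [pi h]; the factor [c] below scales that norm to 1. *)
pose t := inf S.
have t0 : 0 <= t by apply: lb_le_inf; [exists M0|move=> M []].
have let_ y : l2sq (pi h y) <= t * l2sq y.
  have [y0|] := eqVneq (l2sq y) 0; first by have := leM0 y; rewrite y0 !mulr0.
  rewrite neq_lt ltNge l2sq_ge0 /= => y0; rewrite -ler_pdivrMr//.
  by apply: lb_le_inf; [exists M0|move=> M [_ leM]; rewrite ler_pdivrMr].
case: (leP t (cnorm h ^+ 2)) => [le_th|lt_ht].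
  by apply: le_trans (let_ x) _; rewrite ler_wpM2r ?l2sq_ge0.
have t_gt0 : 0 < t by apply: le_lt_trans lt_ht; rewrite sqr_ge0.
pose c : R := (Num.sqrt t)^-1; have c2 : c ^+ 2 = t^-1.
  by rewrite exprVn sqr_sqrtr.
pose k := c%:C *: h.
have kk : star k = k by rewrite starZ hh -[Num.conj _]/(conjc _) conjc_real.
have c_ge0 : 0 <= c by rewrite invr_ge0 sqrtr_ge0.
have nk : cnorm (k * k) < 1.
  have -> : k * k = star k * k by rewrite kk.
  rewrite cnorm_star_mul cnormZ Re_normC_real ger0_norm// exprMn c2.
  by rewrite mulrC ltr_pdivrMr// mul1r.
have sqk y : l2sq (pi k y) = t^-1 * l2sq (pi h y).
  by rewrite piZ l2sqZ /sqnormc/= expr0n addr0 c2.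
have lek y : l2sq (pi k y) <= l2sq y.
  by rewrite sqk mulrC ler_pdivrMr// mulrC let_.
have [r r1] := neumann nk.
have [C C0 leC] := pi_l2sq_bounded r.
(* Self-adjointness gives |y - k^2 y|^2 = |y|^2 - 2 |k y|^2 + |k^2 y|^2, and |k^2 y| <= |k y| <=
   |y|. *)
have gap y : (1 + C) * l2sq (pi k y) <= C * l2sq y.
  have: l2sq y <= C * l2sq (y - pi (k * k) y).
    by rewrite -{1}(pi1 y) -r1 piM piB pi1.
  rewrite l2sqB Re_l2dot_selfadjoint// piM.
  have := lek y; have := lek (pi k y); have := l2sq_ge0 (pi k y); nra.
pose t' := t * (C / (1 + C)).
have C1 : 0 < 1 + C by lra.
have St' : S t'.
  split=> [|y]; first by rewrite mulr_ge0// divr_ge0// ltW.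
  have leg := gap y; rewrite sqk in leg.
  have e : l2sq (pi h y) = t / (1 + C) * ((1 + C) * (t^-1 * l2sq (pi h y))).
    by field; rewrite !gt_eqF.
  have -> : t' * l2sq y = t / (1 + C) * (C * l2sq y) by rewrite /t'; field; rewrite gt_eqF.
  by rewrite [leLHS]e ler_pM2l// divr_gt0.
have : t <= t' by apply: ge_inf => //; case: hasS.
rewrite /t' ler_pMr// ler_pdivlMr// mul1r; lra.
Qed.

End Contraction.

(** * Monomials in the generators *)

Section TwistedMonomials.
Variables (R : realType) (n l : nat) (z : 'I_n -> 'I_n -> R[i]).
Hypothesis hz : forall i j, i != j -> `|z i j| = 1.
Hypothesis hzC : forall i j, i != j -> z j i = (z i j)^*.
Variables (A : cstarAlgType R) (s : 'I_n -> A).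
Hypothesis hs : twisted_relations l z s.
Implicit Types (i j : 'I_n) (k : 'I_n -> int) (Z : pred 'I_n) (r : seq 'I_n).

Lemma twist_neq0 i j : i != j -> z i j != 0.
Proof. by move=> /hz nz; rewrite -normr_gt0 nz. Qed.

Lemma gen_isometry i : star (s i) * s i = 1.
Proof.
have [_ _ lt_l ge_l] := hs.
by case: (ltnP i l) => il; [exact: lt_l|case: (ge_l i il)].
Qed.

Lemma gen_unitary i : (l <= i)%N -> s i * star (s i) = 1.
Proof. by have [_ _ _ ge_l] := hs; case/ge_l. Qed.

Lemma genC i j : i != j -> s i * s j = z i j *: (s j * s i).
Proof. by have [_ + _ _] := hs; apply. Qed.

Lemma star_genC i j : i != j -> star (s i) * s j = z j i *: (s j * star (s i)).
Proof. by move=> ij; case: hs => [/(_ i j ij) -> _ _ _]; rewrite (hzC ij). Qed.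

Lemma gen_starC i j : i != j ->
  s i * star (s j) = (z i j)^-1 *: (star (s j) * s i).
Proof.
move=> ij; rewrite star_genC 1?eq_sym// scalerA mulVf ?scale1r//.
exact: twist_neq0.
Qed.

Lemma star_gen_starC i j : i != j ->
  star (s i) * star (s j) = z i j *: (star (s j) * star (s i)).
Proof.
move=> ij; rewrite -starM genC 1?eq_sym// starZ starM; congr (_ *: _).
by rewrite (hzC ij) conjCK.
Qed.

Lemma scaled_commX (x y : A) c m : x * y = c *: (y * x) ->
  x * y ^+ m = c ^+ m *: (y ^+ m * x).
Proof.
move=> xy; elim: m => [|m IH]; first by rewrite !expr0 mulr1 mul1r scale1r.
rewrite exprS mulrA xy -scalerAl -[y * x * _]mulrA IH -scalerAr scalerA.
by rewrite -exprS mulrA.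
Qed.

(** For i >= l this is the integer power of a unitary, whose inverse is its star. For i < l a
    multi-index supplies only nonnegative exponents. *)
Definition gen_pow i (m : int) : A :=
  match m with Posz m => s i ^+ m | Negz m => star (s i) ^+ m.+1 end.

Lemma gen_powC i j (m : int) : i != j ->
  s i * gen_pow j m = z i j ^ m *: (gen_pow j m * s i).
Proof.
move=> ij; case: m => m /=; first exact/scaled_commX/genC.
by rewrite NegzE -exprnN -exprVn; apply/scaled_commX/gen_starC.
Qed.

Lemma star_gen_powC i j (m : int) : i != j ->
  exists c, star (s i) * gen_pow j m = c *: (gen_pow j m * star (s i)).
Proof.
move=> ij; case: m => m /=; eexists.
  exact/scaled_commX/star_genC.
exact/scaled_commX/star_gen_starC.
Qed.

Lemma gen_powS i (m : int) : (i < l)%N ==> (0 <= m) ->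
  s i * gen_pow i m = gen_pow i (m + 1).
Proof.
case: m => [m|m]; first by rewrite -PoszD addn1 /= exprS.
rewrite implybF -leqNgt => /gen_unitary sis.
case: m => [|m]; first by rewrite /= expr1 sis.
have -> : Negz m.+1 + 1 = Negz m by rewrite !NegzE; lia.
by rewrite /= exprS mulrA sis mul1r.
Qed.

Lemma cnorm_gen_pow_le1 i (m : nat) : cnorm (s i ^+ m) <= 1.
Proof.
apply: le_trans (cnormX_le _ _) _; rewrite exprn_ile1 ?cnorm_ge0//.
exact/cnorm_isometry/gen_isometry.
Qed.

Definition monomial r k : A := \prod_(j <- r) gen_pow j (k j).

Lemma eq_monomial r k k' : {in r, k =1 k'} -> monomial r k = monomial r k'.
Proof. by move=> kk'; apply: eq_big_seq => j /kk' ->. Qed.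

Lemma gen_monomialC i r k : i \notin r ->
  s i * monomial r k = (\prod_(j <- r) z i j ^ k j) *: (monomial r k * s i).
Proof.
elim: r => [|j r IH]; first by rewrite /monomial !big_nil mulr1 mul1r scale1r.
rewrite inE negb_or => /andP[ij ir]; rewrite /monomial !big_cons.
rewrite mulrA gen_powC// -scalerAl -[_ * s i * _]mulrA.
rewrite -[\prod_(_ <- r) gen_pow _ _]/(monomial r k).
by rewrite IH// -scalerAr scalerA mulrA.
Qed.

(** Serves to carry [star (s i)] through the monomial to the defects, where it gives 0; hence only
    the existence of the scalar is stated. As k i = 0, the factor of index i is 1. *)
Lemma star_gen_monomialC i r k : k i = 0 ->
  exists c, star (s i) * monomial r k = c *: (monomial r k * star (s i)).
Proof.
move=> ki; elim: r => [|j r [c IH]].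
  by exists 1; rewrite /monomial !big_nil mulr1 mul1r scale1r.
rewrite /monomial !big_cons -[\prod_(_ <- r) gen_pow _ _]/(monomial r k).
have [<-|ij] := eqVneq i j.
  by exists c; rewrite ki /= expr0 !mul1r.
have [d jd] := star_gen_powC (k j) ij; exists (d * c).
by rewrite mulrA jd -scalerAl -[_ * star _ * _]mulrA IH -scalerAr scalerA mulrA.
Qed.

(** The coefficient of the shifted basis vector in S_i eps_k. *)
Definition phase i k : R[i] := \prod_(j < n | (j < i)%N) z i j ^ k j.

Lemma phase_neq0 i k : phase i k != 0.
Proof.
apply/prodf_neq0 => j ji; rewrite expfz_neq0// twist_neq0//.
by rewrite -val_eqE /= gtn_eqF.
Qed.

Lemma enum_splitP i : exists r1 r2, [/\ enum 'I_n = r1 ++ i :: r2,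
  {in r1, forall j, (j < i)%N} & {in r2, forall j, (i < j)%N}].
Proof.
have : pairwise (relpre val ltn) (enum 'I_n).
  rewrite -pairwise_map val_enum_ord -sorted_pairwise ?iota_ltn_sorted//.
  exact: ltn_trans.
have /path.splitPr : i \in enum 'I_n by rewrite mem_enum.
case=> r1 r2; rewrite pairwise_cat allrel_consr /= => /and3P[/andP[r1i _] _].
case/andP=> r2i _; exists r1, r2; split=> // j; first exact: (allP r1i).
exact: (allP r2i).
Qed.

(** Moving [s i] past the powers of index below i produces exactly [phase i k], after which it is
    absorbed by the power of [s i]. Left multiplication thus acts on monomials as S_i acts on the
    basis. *)
Lemma gen_monomial i k k' : (i < l)%N ==> (0 <= k i) ->
  (forall j, k' j = k j + (j == i)%:R) ->
  s i * monomial (enum 'I_n) k = phase i k *: monomial (enum 'I_n) k'.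
Proof.
move=> ki kk'; have [r1 [r2 [er r1i r2i]]] := enum_splitP i.
have ir1 : i \notin r1 by apply/negP => /r1i; rewrite ltnn.
have -> : phase i k = \prod_(j <- r1) z i j ^ k j.
  have -> : phase i k = \prod_(j <- enum 'I_n | (j < i)%N) z i j ^ k j.
    by rewrite big_enum_cond; apply: eq_bigl.
  rewrite er big_cat big_cons ltnn /=.
  rewrite [X in _ * X]big_seq_cond [X in _ * X]big_pred0 => [|j]; last first.
    by apply/andP => -[/r2i] /=; lia.
  rewrite mulr1 big_seq_cond [RHS]big_seq; apply: eq_bigl => j.
  by case: (boolP (j \in r1)) => // /r1i ->.
rewrite er /monomial !big_cat !big_cons -/(monomial r1 k) -/(monomial r1 k').
rewrite mulrA gen_monomialC// -scalerAl -[_ * s i * _]mulrA [s i * _]mulrA gen_powS//.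
rewrite -/(monomial r2 k) -/(monomial r2 k') kk' eqxx.
rewrite -(@eq_monomial r1 k k') => [|j /r1i ji]; last first.
  by rewrite kk' -val_eqE /= ltn_eqF ?addr0.
rewrite -(@eq_monomial r2 k k') // => j /r2i ji.
by rewrite kk' -val_eqE /= gtn_eqF ?addr0.
Qed.

(** The projection onto the complement of the range of the isometry [s i]; it is 0 for i >= l. *)
Definition defect i : A := 1 - s i * star (s i).

Lemma gen_defectC i j : i != j -> s i * defect j = defect j * s i.
Proof.
move=> ij; rewrite mulrBr mulrBl mulr1 mul1r mulrA genC// -scalerAl -!mulrA.
by rewrite gen_starC// -scalerAr scalerA mulfV ?scale1r// twist_neq0.
Qed.

Lemma star_defect i : star (defect i) = defect i.
Proof. by rewrite starB star1 starM starK. Qed.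

Lemma star_gen_defectC i j : i != j ->
  star (s i) * defect j = defect j * star (s i).
Proof.
by move=> /gen_defectC/(congr1 (@star R A)); rewrite !starM star_defect.
Qed.

Lemma star_gen_defect i : star (s i) * defect i = 0.
Proof. by rewrite mulrBr mulr1 mulrA gen_isometry mul1r subrr. Qed.

Lemma cnorm_defect_le2 i : cnorm (defect i) <= 2.
Proof.
apply: le_trans (cnormB _ _) _.
have := cnormM (s i) (star (s i)); have := cnorm_isometry (gen_isometry i).
rewrite cnorm_star; have := cnorm_ge0 (s i); have := @cnorm1_le1 R A; nra.
Qed.

Definition defects r Z : A := \prod_(j <- r | Z j) defect j.

Lemma star_gen_defects i r Z : i \in r -> Z i -> star (s i) * defects r Z = 0.
Proof.
move=> + Zi; elim: r => [//|j r IH]; rewrite inE /defects big_cons.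
have [<- _|ij /= ir] := eqVneq i j; first by rewrite Zi mulrA star_gen_defect mul0r.
by case: (Z j); [rewrite mulrA star_gen_defectC// -mulrA|]; rewrite IH// mulr0.
Qed.

Lemma gen_defectsC i r Z m : i \notin r ->
  s i ^+ m * defects r Z = defects r Z * s i ^+ m.
Proof.
move=> ir; apply/commr_sym/commrX/commr_sym; rewrite /defects big_seq_cond.
apply: commr_prod => j /andP[jr _]; apply: gen_defectC.
by apply: contraNneq ir => ->.
Qed.

Lemma cnorm_defects_le r Z : cnorm (defects r Z) <= 2 ^+ size r.
Proof.
elim: r => [|j r IH]; first by rewrite /defects big_nil cnorm1_le1.
rewrite /defects big_cons /= exprS; case: (Z j).
  apply: le_trans (cnormM _ _) _.
  by rewrite ler_pM ?cnorm_ge0 ?cnorm_defect_le2.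
by apply: le_trans IH _; rewrite ler_peMl ?exprn_ge0// ler1n.
Qed.

Lemma cnorm_le_sum_blocks i d (x : A) : cnorm x <=
  \sum_(b < d.+1) cnorm (x * s i ^+ b * (if (b < d)%N then defect i else 1)).
Proof.
have resolve m : \sum_(b < m) s i ^+ b * defect i * star (s i) ^+ b =
    1 - s i ^+ m * star (s i) ^+ m.
  elim: m => [|m IH]; first by rewrite big_ord0 !expr0 mulr1 subrr.
  rewrite big_ord_recr IH /= mulrBr mulr1 mulrBl addrA subrK.
  by rewrite mulrA -exprSr -mulrA -exprS.
rewrite -{1}(mulr1 x) -{1}(subrK (s i ^+ d * star (s i) ^+ d) 1) -resolve.
rewrite mulrDr mulr_sumr big_ord_recr /= ltnn /= mulr1.
apply: le_trans (cnormD _ _) _; apply: lerD.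
  apply: le_trans (cnorm_sum _ _ _) _; apply: ler_sum => b _.
  rewrite ltn_ord !mulrA; apply: le_trans (cnormM _ _) _.
  rewrite -starX cnorm_star ler_piMr ?cnorm_ge0//.
  exact: cnorm_gen_pow_le1.
rewrite mulrA; apply: le_trans (cnormM _ _) _.
rewrite -starX cnorm_star ler_piMr ?cnorm_ge0//.
exact: cnorm_gen_pow_le1.
Qed.

End TwistedMonomials.

(** * Polynomials of bounded degree *)

Section Action.
Variables (R : realType) (n l : nat) (z : 'I_n -> 'I_n -> R[i]).
Hypothesis hz : forall i j, i != j -> `|z i j| = 1.
Hypothesis hzC : forall i j, i != j -> z j i = (z i j)^*.
Variables (A : cstarAlgType R) (s : 'I_n -> A).
Hypothesis hs : twisted_relations l z s.
Variable pi : A -> l2 R (multi_index n l) -> l2 R (multi_index n l).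
Hypothesis hpi : is_standard_representation z s pi.
Implicit Types (i j : 'I_n) (k m : multi_index n l) (Z : pred 'I_n).
Implicit Types (u v : l2 R (multi_index n l)) (a b p w x y : A).

Let pi_rep : star_representation pi. Proof. by case: hpi. Qed.

Lemma multi_index_ge0 k i : (i < l)%N -> 0 <= k i.
Proof. by move=> il; have /forallP/(_ i) := multi_indexP k; rewrite il. Qed.

Lemma shift_indexE i k j : shift_index i k j = k j + (j == i)%:R.
Proof. by rewrite /= ffunE. Qed.

Lemma pi_gen i k : pi (s i) (l2basis R k) = phase z i k *: l2basis R (shift_index i k).
Proof. by case: hpi => _ ->. Qed.

Lemma pi_star_gen_shift i k : pi (star (s i)) (l2basis R (shift_index i k)) =
  (phase z i k)^-1 *: l2basis R k.
Proof.
have -> : l2basis R (shift_index i k) = (phase z i k)^-1 *: pi (s i) (l2basis R k).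
  by rewrite pi_gen scalerA mulVf ?scale1r// phase_neq0.
by rewrite (pi_scaler pi_rep) -(piM pi_rep) (gen_isometry hs) (pi1 pi_rep).
Qed.

(** The coordinate at m is the inner product of eps_k with S_i eps_m, a multiple of a basis vector
    whose index at i is positive. *)
Lemma pi_star_gen_eq0 i k : (i < l)%N -> k i = 0 ->
  pi (star (s i)) (l2basis R k) = 0.
Proof.
move=> il ki; apply: l2P => m; rewrite l2val0.
have := pi_star pi_rep (s i) (l2basis R k) (l2basis R m).
rewrite pi_gen l2dot_basisr -[l2basis R m]scale1r l2dot_basisr.
rewrite rmorph1 mulr1 => ->; rewrite l2basisE; case: eqP => [e|_]; last exact: mul0r.
have := shift_indexE i m i; rewrite e ki eqxx; have := multi_index_ge0 m il; lia.
Qed.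

Lemma unshift_index i k : (i < l)%N ==> (0 < k i) -> exists m, shift_index i m = k.
Proof.
move=> ki; have km : [forall j : 'I_n, (j < l)%N ==>
    (0 <= [ffun j => k j - (j == i)%:R] j)].
  apply/forallP => j; apply/implyP => jl; rewrite ffunE.
  have [ji|_] := eqVneq j i; last by rewrite subr0 multi_index_ge0.
  by subst j; move: ki; rewrite jl /=; lia.
exists (MultiIndex km); apply/val_inj/ffunP => j.
by rewrite -[LHS]/(shift_index i (MultiIndex km) j) shift_indexE /= ffunE subrK.
Qed.

(* The counterpart in A of eps_k: as eps_k does when k i = 0 for all i in Z, it
   vanishes under star (s i) for i in Z with k i = 0. *)
Definition vec k Z : A := monomial s (enum 'I_n) k * defects s (enum 'I_n) Z.

Lemma gen_vec i k Z : s i * vec k Z = phase z i k *: vec (shift_index i k) Z.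
Proof.
rewrite mulrA (@gen_monomial _ _ _ _ hz hzC _ _ hs _ k (shift_index i k)).
- by rewrite -scalerAl.
- by apply/implyP; exact: multi_index_ge0.
- exact: shift_indexE.
Qed.

Lemma star_gen_vec_shift i k Z : star (s i) * vec (shift_index i k) Z =
  (phase z i k)^-1 *: vec k Z.
Proof.
have -> : vec (shift_index i k) Z = (phase z i k)^-1 *: (s i * vec k Z).
  by rewrite gen_vec scalerA mulVf ?scale1r// phase_neq0.
by rewrite -scalerAr mulrA (gen_isometry hs) mul1r.
Qed.

Lemma star_gen_vec_eq0 i k Z : Z i -> k i = 0 -> star (s i) * vec k Z = 0.
Proof.
move=> Zi ki; rewrite mulrA.
have [c ->] := star_gen_monomialC hzC hs (enum 'I_n) ki.
by rewrite -scalerAl -mulrA (star_gen_defects hz hzC hs) ?mulr0 ?scaler0 ?mem_enum.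
Qed.

Lemma cnorm_vec_le k Z : cnorm (vec k Z) <= 2 ^+ n.
Proof.
apply: le_trans (cnormM _ _) _; rewrite -[leRHS]mul1r.
apply: ler_pM; rewrite ?cnorm_ge0//; last first.
  by rewrite -[in leRHS](size_enum_ord n); exact: cnorm_defects_le hs _ _.
rewrite /monomial; elim/big_ind: _ => [|x y x1 y1|j _]; first exact: cnorm1_le1.
  apply: le_trans (cnormM _ _) _; rewrite -[leRHS]mul1r.
  by apply: ler_pM; rewrite ?cnorm_ge0.
by case: (k j) => t /=; rewrite -?starX ?cnorm_star; exact: cnorm_gen_pow_le1 hs _ _.
Qed.

Definition near_index (k : multi_index n l) (d : nat) (m : multi_index n l) :=
  forall i, `|m i - k i| <= d%:Z.

(** The same finite combination formed twice: of the eps_m in the Hilbert space and of the [vec m Z]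
    in the algebra, with all m within [d] of [k]. Being a relation, it presupposes no linear map
    between the two sides. *)
Inductive aligned (k : multi_index n l) (d : nat) (Z : pred 'I_n) :
    l2 R (multi_index n l) -> A -> Prop :=
| Aligned0 : aligned k d Z 0 0
| AlignedD (c : R[i]) m u w : near_index k d m -> aligned k d Z u w ->
    aligned k d Z (c *: l2basis R m + u) (c *: vec m Z + w).

Lemma aligned_basis k d Z c m : near_index k d m ->
  aligned k d Z (c *: l2basis R m) (c *: vec m Z).
Proof.
move=> km; rewrite -[c *: l2basis R m]addr0 -[c *: vec m Z]addr0.
by apply: AlignedD => //; exact: Aligned0.
Qed.

Lemma aligned_linear k d Z c u w u' w' : aligned k d Z u w ->
  aligned k d Z u' w' -> aligned k d Z (c *: u + u') (c *: w + w').
Proof.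
move=> uw u'w'; elim: uw => [|e m v x km _ IH]; first by rewrite !scaler0 !add0r.
by rewrite !scalerDr !scalerA -!addrA; apply: AlignedD.
Qed.

Lemma aligned_widen k d Z k' d' u w :
  (forall m, near_index k d m -> near_index k' d' m) ->
  aligned k d Z u w -> aligned k' d' Z u w.
Proof.
move=> kk'; elim=> [|e m v x km _ IH]; first exact: Aligned0.
by apply: AlignedD => //; exact: kk'.
Qed.

(* For i outside Z, the exponent k i must be large enough not to become
   negative under x, since vec k Z need not vanish under star (s i). *)
Definition degree_le d x := forall k Z,
  (forall i, (i < l)%N -> ~~ Z i -> d%:Z <= k i) ->
  aligned k d Z (pi x (l2basis R k)) (x * vec k Z).

Lemma degree_leW d d' x : (d <= d')%N -> degree_le d x -> degree_le d' x.
Proof.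
move=> dd' dx k Z kd; apply: (@aligned_widen k d) => [m km i|].
  by apply: le_trans (km i) _; rewrite lez_nat.
by apply: dx => i il Zi; apply: le_trans (kd i il Zi); rewrite lez_nat.
Qed.

Lemma degree_le1 : degree_le 0 1.
Proof.
move=> k Z _; rewrite (pi1 pi_rep) mul1r.
rewrite -[l2basis R k]scale1r -[vec k Z]scale1r; apply: aligned_basis => i.
by rewrite subrr normr0.
Qed.

Lemma degree_le_linear d c x y : degree_le d x -> degree_le d y ->
  degree_le d (c *: x + y).
Proof.
move=> dx dy k Z kd; rewrite (piD pi_rep) (piZ pi_rep) mulrDl -scalerAl.
by apply: aligned_linear; [exact: dx|exact: dy].
Qed.

Lemma degree_leZ d c x : degree_le d x -> degree_le d (c *: x).
Proof.
move=> dx; rewrite -[c *: x]addr0; apply: degree_le_linear => // k Z _.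
by rewrite (pi0 pi_rep) mul0r; exact: Aligned0.
Qed.

(** [y] displaces k by at most d', so a margin of d + d' outside Z still leaves d for [x] at every
    index reached. *)
Lemma degree_leM d d' x y : degree_le d x -> degree_le d' y ->
  degree_le (d + d') (x * y).
Proof.
move=> dx dy k Z kd; rewrite (piM pi_rep) -mulrA.
have: aligned k d' Z (pi y (l2basis R k)) (y * vec k Z).
  by apply: dy => i il Zi; have := kd i il Zi; lia.
elim=> [|c m u w km _ IH]; first by rewrite (pi_zero pi_rep) mulr0; exact: Aligned0.
rewrite (pi_linear pi_rep) mulrDr -scalerAr; apply: aligned_linear IH.
apply: (@aligned_widen m d) => [m' mm' i|].
  by have := km i; have := mm' i; lia.
by apply: dx => i il Zi; have := kd i il Zi; have := km i; lia.
Qed.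

Lemma degree_leX d x e : degree_le d x -> degree_le (d * e) (x ^+ e).
Proof.
move=> dx; elim: e => [|e IH]; first by rewrite muln0; exact: degree_le1.
by rewrite mulnS exprS; exact: degree_leM.
Qed.

Lemma near_shift i k : near_index k 1 (shift_index i k).
Proof. by move=> j; rewrite shift_indexE; case: (j == i); lia. Qed.

Lemma near_unshift i k : near_index (shift_index i k) 1 k.
Proof. by move=> j; rewrite shift_indexE; case: (j == i); lia. Qed.

Lemma degree_le_gen i : degree_le 1 (s i).
Proof.
move=> k Z _; rewrite pi_gen gen_vec; apply: aligned_basis; exact: near_shift.
Qed.

(** Either k is a shift in direction i and [star (s i)] undoes it on both sides, or i < l and k i =
    0. In the latter case the margin 1 forces i into Z, and both sides vanish. *)
Lemma degree_le_star_gen i : degree_le 1 (star (s i)).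
Proof.
move=> k Z kd; have [ki|] := boolP ((i < l)%N ==> (0 < k i)).
  have [m <-] := unshift_index ki.
  rewrite pi_star_gen_shift star_gen_vec_shift; apply: aligned_basis.
  exact: near_unshift.
rewrite negb_imply => /andP[il]; have := multi_index_ge0 k il.
rewrite le_eqVlt => /predU1P[/esym ki _|-> //].
rewrite pi_star_gen_eq0// star_gen_vec_eq0//; first exact: Aligned0.
by apply: contraT => Zi; have := kd i il Zi; rewrite ki.
Qed.

(** * Counting indices and the polynomial norm estimate *)

(** The offsets 0..2d are shifted by -d, and [insub] discards the tuples that are negative at some i
    < l. *)
Definition box k d : seq (multi_index n l) := undup (pmap insub
  [seq [ffun i => k i + (o i)%:Z - d%:Z] | o : {ffun 'I_n -> 'I_(d.*2.+1)}]).

Lemma size_box k d : (size (box k d) <= d.*2.+1 ^ n)%N.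
Proof.
apply: leq_trans (size_undup _) _; rewrite size_pmap.
apply: leq_trans (count_size _ _) _.
by rewrite size_map -cardE card_ffun !card_ord.
Qed.

Lemma mem_box k d m : near_index k d m -> m \in box k d.
Proof.
move=> km; rewrite mem_undup mem_pmap; apply/mapP; exists (val m); last first.
  by rewrite valK.
apply/mapP; exists [ffun i => inord (absz (m i - k i + d%:Z))]; first by rewrite mem_enum.
apply/ffunP => i; rewrite !ffunE inordK; have := km i; rewrite /=; lia.
Qed.

(** The coefficients of [w] are the coordinates of [u], so bounds on [pi p] become bounds on
    products in the algebra. *)
Lemma aligned_coord k d Z u w : aligned k d Z u w ->
  w = \sum_(m <- box k d) u m *: vec m Z.
Proof.
elim=> [|c m v x km _ ->]; first by rewrite big1 // => m _; rewrite l2val0 scale0r.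
under [RHS]eq_bigr do rewrite l2valD l2valZ l2basisE scalerDl.
rewrite big_split/=; congr (_ + _).
rewrite (bigD1_seq m) ?undup_uniq ?mem_box//= eqxx mulr1 big1 ?addr0// => m' /negPf ->.
by rewrite mulr0 scale0r.
Qed.

Lemma cnorm_aligned_le k d Z u w (M : R) : 0 <= M -> aligned k d Z u w ->
  (forall m, sqnormc (u m) <= M ^+ 2) ->
  cnorm w <= (d.*2.+1 ^ n)%:R * (M * 2 ^+ n).
Proof.
move=> M0 /aligned_coord -> leM; apply: le_trans (cnorm_sum _ _ _) _.
apply: (@le_trans _ _ (\sum_(m <- box k d) M * 2 ^+ n)).
  apply: ler_sum => m _; rewrite cnormZ; apply: ler_pM; rewrite ?cnorm_ge0 ?cnorm_vec_le//.
    by rewrite normc_def /= sqrtr_ge0.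
  rewrite normc_def /= -(ler_pXn2r (_ : (0 < 2)%N))// ?nnegrE ?sqrtr_ge0//.
  by rewrite sqr_sqrtr ?addr_ge0 ?sqr_ge0// leM.
rewrite big_const_seq count_predT iter_addr_0 -[leLHS]mulr_natl.
by rewrite ler_wpM2r ?mulr_ge0 ?exprn_ge0// ler_nat size_box.
Qed.

Lemma cnorm_degree_le d p (M : R) : 0 <= M -> degree_le d p ->
  (forall u, l2sq (pi p u) <= M ^+ 2 * l2sq u) ->
  cnorm p <= d.+1%:R ^+ n * ((d.*2.+1 ^ n)%:R * (M * 2 ^+ n)).
Proof.
move=> M0 dp leM; set K := _%:R * (M * _).
have K0 : 0 <= K by rewrite !mulr_ge0 ?exprn_ge0.
(* The exponent d marks the last block of [cnorm_le_sum_blocks], which carries no defect. *)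
pose below (k : 'I_n -> int) : pred 'I_n := fun j => (j < l)%N && (k j < d%:Z).
have block (r : seq 'I_n) i (k k' : 'I_n -> int) : i \notin r -> {in r, k =1 k'} ->
    p * monomial s (rcons r i) k' * defects s (rcons r i) (below k') =
    p * monomial s r k * (gen_pow s i (k' i) * defects s r (below k)) *
      (if below k' i then defect s i else 1).
  move=> ir kk'; rewrite /monomial /defects ![\prod_(_ <- _ | _) _]big_mkcond.
  rewrite -!cats1 !big_cat !big_seq1 /= !mulrA; congr (_ * _).
  rewrite -!mulrA; congr (_ * (_ * (_ * _))); apply: eq_big_seq => j jr.
    by rewrite kk'.
  by rewrite /below kk'.
(* [r] lists the generators already split into blocks and [r'] those still to be treated; each of
   the latter costs a factor of at most d + 1. *)
have main r r' (k : 'I_n -> int) : enum 'I_n = r ++ r' ->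
    (forall j, (j < l)%N -> 0 <= k j <= d%:Z) ->
    cnorm (p * monomial s r k * defects s r (below k)) <= d.+1%:R ^+ size r' * K.
  elim: r' r k => [|i r' IH] r k er kd.
    rewrite cats0 in er; subst r; rewrite expr0 mul1r -mulrA.
    have kP : [forall j : 'I_n, (j < l)%N ==> (0 <= [ffun j => k j] j)].
      by apply/forallP => j; apply/implyP => /kd/andP[]; rewrite ffunE.
    pose k' := MultiIndex kP.
    have -> : monomial s (enum 'I_n) k * defects s (enum 'I_n) (below k) =
        vec k' (below k).
      by congr (_ * _); apply: eq_monomial => j _; rewrite /= ffunE.
    apply: (@cnorm_aligned_le k' d (below k) (pi p (l2basis R k'))) => // [|m].
      (* An index j < l outside [below k] has exponent at least d, which is the margin that
         [degree_le] asks for. *)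
      by apply: dp => j jl; rewrite /below jl /= -leNgt ffunE.
    apply: le_trans (sqnormc_le_l2sq _ _) _; apply: le_trans (leM _) _.
    by rewrite l2sq_basis mulr1.
  have ir : i \notin r.
    by have := enum_uniq 'I_n; rewrite er cat_uniq => /and3P[_ /norP[]].
  pose upd (b : int) : 'I_n -> int := fun j => if j == i then b else k j.
  have kupd (b : int) : {in r, k =1 upd b}.
    by move=> j jr; rewrite /upd; case: eqP ir => // <-; rewrite jr.
  have updb (b : int) : upd b i = b by rewrite /upd eqxx.
  have er' : enum 'I_n = rcons r i ++ r' by rewrite cat_rcons.
  have updd (b : int) : (forall j, (j < l)%N -> j == i -> 0 <= b <= d%:Z) ->
      forall j, (j < l)%N -> 0 <= upd b j <= d%:Z.
    move=> bd j jl; rewrite /upd; case: (boolP (j == i)) => [|_]; last exact: kd.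
    exact: bd.
  case: (ltnP i l) => [il|li].
    apply: le_trans (cnorm_le_sum_blocks hs i d _) _.
    have -> : d.+1%:R ^+ size (i :: r') * K =
        \sum_(b < d.+1) d.+1%:R ^+ size r' * K.
      by rewrite sumr_const card_ord exprS -mulrA mulr_natl.
    apply: ler_sum => b _; have := IH (rcons r i) (upd (b : nat)%:Z) er'.
    rewrite (@block r i k)// updb /below updb il ltz_nat /= -[_ * s i ^+ b]mulrA.
    (* The new power of [s i] must pass the defects already present to join the monomial. *)
    rewrite -(gen_defectsC hz hzC hs)//; apply; apply: updd => j _ _.
    by rewrite lez_nat -ltnS ltn_ord.
  (* A unitary generator is not split: it enters with exponent 0 and no defect. *)
  have := IH (rcons r i) (upd 0) er'; rewrite (@block r i k)// /below ltnNge li /=.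
  rewrite mulr1 updb /= expr0 mul1r => /(_ _)/le_trans; apply.
    by apply: updd => j jl /eqP ji; move: jl; rewrite ji ltnNge li.
  by rewrite exprS -mulrA ler_peMl ?mulr_ge0 ?exprn_ge0// ler1n.
have := main [::] (enum 'I_n) (fun=> 0) erefl.
rewrite /monomial /defects !big_nil !mulr1 size_enum_ord; apply => j _.
by rewrite lexx lez_nat.
Qed.

End Action.

(** * Removing the polynomial factor *)

(** If a > b, then (a/b)^(2^j) would grow at most polynomially in 2^j. Bernoulli's inequality yields
    only linear growth, but raising it to a fixed power q > D yields growth of order q, which
    exceeds D. *)
Lemma le_of_poly_growth (R : realType) (a b C : R) (D : nat) : 0 < b -> 0 <= C ->
  (forall j : nat, a ^+ (2 ^ j) <= C * (2 ^ j)%:R ^+ D * b ^+ (2 ^ j)) -> a <= b.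
Proof.
move=> b0 C0 growth; case: (leP a b) => // lt_ba.
pose x := a / b - 1; have x0 : 0 < x by rewrite subr_gt0 ltr_pdivlMr ?mul1r.
have growth_x j : (1 + x) ^+ (2 ^ j) <= C * (2 ^ j)%:R ^+ D.
  rewrite addrC subrK exprMn exprVn ler_pdivrMr ?exprn_gt0//; exact: growth.
have bernoulli t : 1 + t%:R * x <= (1 + x) ^+ t.
  elim: t => [|t IH]; first by rewrite mul0r addr0 expr0.
  rewrite exprS; apply: (@le_trans _ _ ((1 + x) * (1 + t%:R * x))); last first.
    by rewrite ler_pM2l//; lra.
  rewrite -natr1; have : 0 <= t%:R * x * x by rewrite !mulr_ge0// ltW.
  by lra.
(* With t = 2^i and 2^j = t q one has (t x)^q <= (1 + x)^(t q) <= C (t q)^D. As t^(D+1) <= t^q, this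
   gives t <= K for every i, which is absurd. *)
pose q := (2 ^ D.+1)%N; pose K := C * q%:R ^+ D / x ^+ q.
have Dq : (D < q)%N by apply: ltn_trans (ltnSn D) (ltn_expl _ _).
have bounded i : (2 ^ i)%:R <= K.
  set t : R := (2 ^ i)%:R; have t1 : 1 <= t by rewrite ler1n expn_gt0.
  have t0 : 0 < t by lra.
  rewrite ler_pdivlMr ?exprn_gt0//.
  rewrite -(ler_pM2l (exprn_gt0 D t0)).
  have := growth_x (i + D.+1)%N; rewrite expnD -/q exprM natrM -/t => le1.
  have le2 : t ^+ q * x ^+ q <= ((1 + x) ^+ (2 ^ i)) ^+ q.
    rewrite -exprMn; apply: lerXn2r; rewrite ?nnegrE.
    - by rewrite mulr_ge0// ltW.
    - by rewrite exprn_ge0//; lra.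
    by apply: le_trans (bernoulli _); rewrite -/t; lra.
  have le3 : t ^+ D * (t * x ^+ q) <= t ^+ q * x ^+ q.
    rewrite mulrA -exprSr ler_wpM2r ?exprn_ge0 ?(ltW x0)//.
    exact: ler_weXn2l.
  apply: le_trans le3 _; apply: le_trans le2 _; apply: le_trans le1 _.
  by rewrite exprMn mulrCA mulrA.
have [i ltK] : exists i : nat, K < (2 ^ i)%:R.
  exists (Num.trunc K).+1; apply: lt_le_trans (truncnS_gt K) _.
  by rewrite ler_nat ltnW// ltn_expl.
by move: ltK; rewrite ltNge bounded.
Qed.

Section Injectivity.
Variables (R : realType) (n l : nat) (z : 'I_n -> 'I_n -> R[i]).
Hypothesis hz : forall i j, i != j -> `|z i j| = 1.
Hypothesis hzC : forall i j, i != j -> z j i = (z i j)^*.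
Variables (A : cstarAlgType R) (s : 'I_n -> A).
Hypothesis hs : twisted_relations l z s.
Variable pi : A -> l2 R (multi_index n l) -> l2 R (multi_index n l).
Hypothesis hpi : is_standard_representation z s pi.
Implicit Types (a b p w x y : A).

Let pi_rep : star_representation pi. Proof. by case: hpi. Qed.

Lemma cnorm_selfadjoint_le d p (M : R) : 0 < M -> star p = p ->
  degree_le s pi d p -> (forall u, l2sq (pi p u) <= M ^+ 2 * l2sq u) ->
  cnorm p <= M.
Proof.
move=> M0 pp dp leM.
have leMX m u : l2sq (pi (p ^+ m) u) <= (M ^+ m) ^+ 2 * l2sq u.
  elim: m => [|m IH]; first by rewrite !expr0 (pi1 pi_rep) expr1n mul1r.
  rewrite exprS (piM pi_rep) (exprS M) exprMn -mulrA; apply: le_trans (leM _) _.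
  by rewrite ler_wpM2l ?sqr_ge0.
(* p^(2^j) has degree at most d 2^j. Both counts in [cnorm_degree_le], of blocks and of box indices,
   are then at most ((2d + 1) 2^j)^n, while 2^n bounds the norm of [vec]. *)
apply: (@le_of_poly_growth _ _ _ (2 ^+ n * (d.*2.+1%:R ^+ n) ^+ 2) (n + n)) => // j.
rewrite -cnorm_selfadjointX2//; set m := (2 ^ j)%N.
have m1 : (0 < m)%N by rewrite expn_gt0.
have := cnorm_degree_le hz hzC hs (exprn_ge0 m (ltW M0))
  (degree_leX (e := m) hpi dp) (leMX m).
move/le_trans; apply; rewrite natrX.
set N := d.*2.+1%:R : R; set P := m%:R : R.
have le1 : (d * m).+1%:R <= N * P :> R.
  by rewrite -natrM ler_nat; nia.
have le2 : (d * m).*2.+1%:R <= N * P :> R.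
  by rewrite -natrM ler_nat; nia.
have -> : 2 ^+ n * (N ^+ n) ^+ 2 * P ^+ (n + n) * M ^+ m =
    (N * P) ^+ n * ((N * P) ^+ n * (M ^+ m * 2 ^+ n)).
  by rewrite !exprMn exprD; ring.
have Mm : 0 <= M ^+ m * 2 ^+ n by rewrite mulr_ge0 ?exprn_ge0 ?(ltW M0).
apply: ler_pM; rewrite ?mulr_ge0 ?exprn_ge0 ?(ltW M0)//.
  by apply: lerXn2r; rewrite ?nnegrE ?mulr_ge0.
by rewrite ler_wpM2r//; apply: lerXn2r; rewrite ?nnegrE ?mulr_ge0.
Qed.

(** The bound is required of [star p] as well, which makes closure under the star immediate. *)
Definition star_polynomial p :=
  exists d, degree_le s pi d p /\ degree_le s pi d (star p).

Lemma star_polynomial_subalgebra : star_subalgebra star_polynomial.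
Proof.
split.
- by exists 0%N; rewrite star1; split; exact: (degree_le1 hpi).
- move=> c x y [d [dx dx']] [e [ey ey']]; exists (maxn d e).
  rewrite starD starZ; split; apply: (degree_le_linear hpi).
  + exact: degree_leW (leq_maxl _ _) dx.
  + exact: degree_leW (leq_maxr _ _) ey.
  + exact: degree_leW (leq_maxl _ _) dx'.
  + exact: degree_leW (leq_maxr _ _) ey'.
- move=> x y [d [dx dx']] [e [ey ey']]; exists (d + e)%N; rewrite starM.
  by split; [|rewrite addnC]; exact: (degree_leM hpi).
- by move=> x [d [dx dx']]; exists d; rewrite starK.
Qed.

Lemma star_polynomial_gen i : star_polynomial (s i).
Proof.
exists 1%N; split; first exact: (degree_le_gen hz hzC hs hpi).
exact: (degree_le_star_gen hz hzC hs hpi).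
Qed.

End Injectivity.

(** * Norm closure of a star subalgebra *)

Definition cclosure (R : realType) (A : cstarAlgType R) (B : set A) : set A :=
  [set a | forall e : R, 0 < e -> exists2 p, B p & cnorm (a - p) < e].

Lemma cclosure_subalgebra (R : realType) (A : cstarAlgType R) (B : set A) :
  star_subalgebra B -> star_subalgebra (cclosure B).
Proof.
move=> [B1 BD BM BS]; split.
- by move=> e e0; exists 1 => //; rewrite subrr cnorm0.
- move=> c x y Bx By e e0.
  have e2 : 0 < e / 2 by lra.
  pose C := complex.Re `|c|; have C0 : 0 <= C by rewrite /C normc_def sqrtr_ge0.
  have [p Bp xp] := Bx (e / 2 / (C + 1)) (divr_gt0 e2 (ltr_pwDr ltr01 C0)).
  have [q Bq yq] := By _ e2; exists (c *: p + q); first exact: BD.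
  rewrite opprD addrACA -scalerBr; apply: le_lt_trans (cnormD _ _) _.
  rewrite cnormZ -/C; move: xp; rewrite ltr_pdivlMr; last lra.
  have := cnorm_ge0 (x - p); nra.
- move=> x y Bx By e e0.
  have y1 : 0 < e / 2 / (cnorm y + 1).
    by rewrite !divr_gt0//; have := cnorm_ge0 y; lra.
  have [p Bp] := Bx _ y1; rewrite ltr_pdivlMr; last by have := cnorm_ge0 y; lra.
  (* The tolerance for [q] depends on |p|, so [p] is chosen first; the added 1 keeps the
     denominators positive. *)
  move=> xp; have p1 : 0 < e / 2 / (cnorm p + 1).
    by rewrite !divr_gt0//; have := cnorm_ge0 p; lra.
  have [q Bq] := By _ p1; rewrite ltr_pdivlMr; last by have := cnorm_ge0 p; lra.
  move=> yq; exists (p * q); first exact: BM.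
  have -> : x * y - p * q = (x - p) * y + p * (y - q).
    by rewrite mulrBl mulrBr addrA subrK.
  apply: le_lt_trans (cnormD _ _) _.
  have := cnormM (x - p) y; have := cnormM p (y - q).
  have := cnorm_ge0 (x - p); have := cnorm_ge0 (y - q); nra.
- move=> x Bx e e0; have [p Bp xp] := Bx e e0.
  by exists (star p); [exact: BS|rewrite -starB cnorm_star].
Qed.

Lemma cclosure_closed (R : realType) (A : cstarAlgType R) (B : set A) :
  norm_closed (cclosure B).
Proof.
move=> u a Bu ua e e0; have e2 : 0 < e / 2 by lra.
move/cvgrPdist_lt: ua => /(_ _ e2) [N _ /(_ N (leqnn N))] /=.
rewrite sub0r normrN ger0_norm ?cnorm_ge0// cnorm_distC => aN.
have [p Bp uNp] := Bu N _ e2; exists p => //.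
rewrite -(subrK (u N) a) -addrA; apply: le_lt_trans (cnormD _ _) _.
by have := ltrD aN uNp; lra.
Qed.

Lemma sub_cclosure (R : realType) (A : cstarAlgType R) (B : set A) :
  B `<=` cclosure B.
Proof. by move=> a Ba e e0; exists a; rewrite ?subrr ?cnorm0. Qed.

(** * Injectivity by approximation with self-adjoint polynomials *)

Theorem theorem2p18 (R : realType) (n l : nat) (hn : (1 <= n)%N)
    (hl : (l <= n)%N) (z : 'I_n -> 'I_n -> R[i])
    (hz : forall i j, i != j -> `|z i j| = 1)
    (hzC : forall i j, i != j -> z j i = (z i j)^*)
    (A : cstarAlgType R) (s : 'I_n -> A) (hA : is_universal l z s)
    (pi : A -> l2 R (multi_index n l) -> l2 R (multi_index n l))
    (hpi : is_standard_representation z s pi) :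
  injective pi.
Proof.
have [hs gens _] := hA; have [pi_rep _] := hpi.
have dense : cclosure (star_polynomial s pi) = setT.
  apply: gens; first exact/cclosure_subalgebra/(star_polynomial_subalgebra hpi).
    exact: cclosure_closed.
  by move=> i; apply: sub_cclosure; exact: (star_polynomial_gen hz hzC hs hpi).
move=> x y xy; apply/eqP; rewrite -subr_eq0; set a := x - y.
have pia u : pi a u = 0 by rewrite (piB pi_rep) xy subrr.
(* Passing to [star a * a] gives a self-adjoint element of the kernel, and the C*-identity recovers
   [a] from it. *)
pose b := star a * a; have bb : star b = b by rewrite starM starK.
have pib u : pi b u = 0 by rewrite (piM pi_rep) pia (pi_zero pi_rep).
suff b0 : cnorm b = 0.
  apply/eqP/cnorm_eq0; apply/eqP; rewrite -sqrf_eq0 -cnorm_star_mul.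
  exact/eqP.
apply/le_anti; rewrite cnorm_ge0 andbT; apply/ler_addgt0Pr => e e0; rewrite add0r.
have e2 : 0 < e / 2 by lra.
have : cclosure (star_polynomial s pi) b by rewrite dense.
move=> /(_ _ e2) [p [d [dp dp']] bp].
(* The real part of [p] is self-adjoint and no farther from the self-adjoint [b] than the bound for
   [p]. *)
pose q := (2^-1)%:C *: p + (2^-1)%:C *: star p.
have half w : (2^-1)%:C *: w + (2^-1)%:C *: w = w :> A.
  rewrite -scalerDl -rmorphD/= (_ : 2^-1 + 2^-1 = 1 :> R) ?scale1r//.
  by field.
have qq : star q = q.
  by rewrite starD !starZ starK -[Num.conj _]/(conjc _) conjc_real addrC.
have dq : degree_le s pi d q.
  by apply: (degree_le_linear hpi) => //; exact: (degree_leZ hpi).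
have bq : cnorm (q - b) <= e / 2.
  rewrite -[X in _ - X]half opprD addrACA -!scalerBr.
  apply: le_trans (cnormD _ _) _; rewrite !cnormZ Re_normC_real.
  rewrite -[X in star p - X]bb -starB cnorm_star cnorm_distC gtr0_norm; last by lra.
  by lra.
have qle : cnorm q <= e / 2.
  (* As [pi b] vanishes, [pi q] is [pi (q - b)], whose norm is at most |q - b| <= e/2. *)
  apply: (@cnorm_selfadjoint_le _ _ _ _ hz hzC _ _ hs _ hpi d) => // u.
  have -> : pi q u = pi (q - b) u by rewrite (piB pi_rep) pib subr0.
  apply: le_trans (pi_contraction pi_rep _ _) _; first by rewrite starB qq bb.
  rewrite ler_wpM2r ?l2sq_ge0// lerXn2r ?nnegrE ?cnorm_ge0// ltW//.
rewrite -(subrK q b); apply: le_trans (cnormD _ _) _.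
by rewrite cnorm_distC; lra.
Qed.
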